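(* Let $a$, $b$, $c$ be non-zero square-free integers that are pairwise relatively prime, and consider the ternary quadratic form $f(x,y,z)=ax^2+by^2+cz^2$. The following statements hold. (1) If $p$ is an odd prime factor of $a$ with $\left(\frac{-bc}{p}\right)=-1$, and $n$ is an integer such that $\left(\frac{(a/p)n}{p}\right)=-1$, then $np$ is not represented by $f$ over the rationals. Likewise, if $p$ is an odd prime factor of $b$ with $\left(\frac{-ac}{p}\right)=-1$ and $n$ is an integer with $\left(\frac{(b/p)n}{p}\right)=-1$, then $np$ is not represented by $f$ over the rationals; and if $p$ is an odd prime factor of $c$ with $\left(\frac{-ab}{p}\right)=-1$ and $n$ is an integer with $\left(\frac{(c/p)n}{p}\right)=-1$, then $np$ is not represented by $f$ over the rationals. (2) Suppose that $a,b,c$ are positive, that $\left(\frac{-bc}{p}\right)=1$ for all odd prime factors $p$ of $a$, that $\left(\frac{-ac}{p}\right)=1$ for all odd prime factors $p$ of $b$, and that $\left(\frac{-ab}{p}\right)=1$ for all odd prime factors $p$ of $c$. Then either $a\equiv b\equiv c \pmod 4$, or one of $a,b,c$ is even and, naming the coefficients so that $a$ is the even one, $b+c\equiv a \pmod 8$ or $b+c\equiv 2a\pmod 8$. (3) If $a\equiv b\equiv c\pmod 4$, then integers congruent to $-abc$ modulo $8$ are not represented by $f$ over the rationals. If one of $a,b,c$ is even and, naming the coefficients so that $a$ is the even one, $b+c\equiv a\pmod 8$ or $b+c\equiv 2a\pmod 8$, then integers congruent to $-abc$ modulo $16$ are not represented by $f$ over the rationals.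
   Context: $\left(\frac{\cdot}{p}\right)$ denotes the Legendre symbol. A number $N$ is represented by $f$ over the rationals if there exist $x,y,z\in\mathbb{Q}$ with $f(x,y,z)=N$. *)

(* Defs.v *)
From mathcomp Require Import all_boot all_order all_algebra.

Set Implicit Arguments.
Unset Strict Implicit.
Unset Printing Implicit Defensive.

Import GRing.Theory Num.Theory.
Local Open Scope ring_scope.

Definition squarefree (n : int) : Prop :=
  forall d : int, (d ^+ 2 %| n)%Z -> d \is a GRing.unit.

(* Only meaningful when p is an odd prime. *)
Definition legendre (n : int) (p : nat) : int :=
  if (p%:Z %| n)%Z then 0
  else if [exists x : 'I_p, ((x : nat)%:Z ^+ 2 == n %[mod p%:Z])%Z] then 1
  else -1.

Definition diag_form (a b c : int) (x y z : rat) : rat :=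
  a%:~R * x ^+ 2 + b%:~R * y ^+ 2 + c%:~R * z ^+ 2.

Definition represented_over_rat (f : rat -> rat -> rat -> rat) (N : int) : Prop :=
  exists x y z : rat, f x y z = N%:~R.

Definition odd_prime_factor (p : nat) (n : int) : Prop :=
  [/\ prime p, odd p & (p%:Z %| n)%Z].

Definition congruent_mod4 (a b c : int) : Prop :=
  (a = b %[mod 4])%Z /\ (b = c %[mod 4])%Z.

Definition even_first_cond (a b c : int) : Prop :=
  (2 %| a)%Z /\ ((b + c = a %[mod 8])%Z \/ (b + c = 2 * a %[mod 8])%Z).

(* For pairwise coprime coefficients at most one is even, so at most one of the
   three cases below applies; it amounts to renaming the even coefficient a. *)
Definition even_coef_cond (a b c : int) : Prop :=
  [\/ even_first_cond a b c, even_first_cond b a c | even_first_cond c a b].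

(* Main.v *)
Require Import Defs.
From mathcomp Require Import all_boot all_order all_algebra.
From mathcomp Require Import zify ring.

(** For (1) and (3), a rational representation of N gives a nonzero integer
    solution of a X^2 + b Y^2 + c Z^2 = N W^2; the hypotheses force p (resp. 2)
    to divide all four unknowns, and infinite descent applies.

    For (2), geometry of numbers replaces the reciprocity law. If the
    congruences fail, then one of a + b, a + c, b + c is divisible by 4 (odd
    case), or, with a even, one of b + c, a + b + c is divisible by 8. Together
    with the square roots of -bc, -ac, -ab modulo the coefficients, this gives a
    sublattice of Z^3 of index 4abc on which the form vanishes modulo 4abc.
    Hermite's bound for positive ternary forms then produces a value strictly
    between 0 and 4abc on it, a contradiction. *)

Import Order.TTheory GRing.Theory Num.Theory.
Local Open Scope ring_scope.

(** * Local obstructions *)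

(** Residues of squares, written linearly in [k] so that the later arguments modulo 8 and 16 can be
    left to [lia]. *)
Lemma sqr_dyadic_cases (x : int) :
  [\/ exists k, x ^+ 2 = 8 * k + 1,
      (2 %| x)%Z /\ exists k, x ^+ 2 = 16 * k
    | (2 %| x)%Z /\ exists k, x ^+ 2 = 32 * k + 4].
Proof.
have odd_sqr (y : int) : exists k, (2 * y + 1) ^+ 2 = 8 * k + 1.
  have [k Hk] : exists k, y * (y + 1) = 2 * k.
    have [q [Hq|Hq]] : exists q, y = 2 * q \/ y = 2 * q + 1.
    - by exists (y %/ 2)%Z; lia.
    - by exists (q * (2 * q + 1)); rewrite Hq; ring.
    - by exists ((2 * q + 1) * (q + 1)); rewrite Hq; ring.
  exists k; transitivity (4 * (y * (y + 1)) + 1); first ring.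
  by rewrite Hk; ring.
have [y [Hy|Hy]] : exists y, x = 2 * y \/ x = 2 * y + 1
  by exists (x %/ 2)%Z; lia.
- have [z [Hz|Hz]] : exists z, y = 2 * z \/ y = 2 * z + 1
    by exists (y %/ 2)%Z; lia.
  + by apply: Or32; split; [lia | exists (z ^+ 2); rewrite Hy Hz; ring].
  + apply: Or33; split; first lia.
    have [k Hk] := odd_sqr z.
    by exists k; rewrite Hy exprMn Hz Hk; ring.
- by have [k Hk] := odd_sqr y; apply: Or31; exists k; rewrite Hy.
Qed.

Lemma rat_representation_int (a b c N : int) :
  represented_over_rat (diag_form a b c) N ->
  exists X Y Z W : int,
    W != 0 /\ a * X ^+ 2 + b * Y ^+ 2 + c * Z ^+ 2 = N * W ^+ 2.
Proof.
rewrite /diag_form => -[x [y [z E]]].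
have dx : (denq x)%:~R != 0 :> rat by rewrite intr_eq0 denq_neq0.
have dy : (denq y)%:~R != 0 :> rat by rewrite intr_eq0 denq_neq0.
have dz : (denq z)%:~R != 0 :> rat by rewrite intr_eq0 denq_neq0.
exists (numq x * denq y * denq z), (denq x * numq y * denq z),
  (denq x * denq y * numq z), (denq x * denq y * denq z).
split; first by rewrite !mulf_neq0 ?denq_neq0.
apply: (@intr_inj rat).
rewrite !rmorphD !rmorphM /= -E.
rewrite ?rmorphXn /= ?rmorphM /=.
(* The seventh occurrence of each variable is the one in the form; the others lie under [numq] and
   [denq]. *)
rewrite -{7}[x]divq_num_den -{7}[y]divq_num_den -{7}[z]divq_num_den.
by field; rewrite dx dy dz.
Qed.

(** Both sides are homogeneous of degree 2, so dividing the four unknowns by [p] gives another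
    solution, whose [W] is still nonzero and strictly smaller in absolute value. *)
Lemma not_represented_by_descent (p : nat) (a b c N : int) : (1 < p)%N ->
  (forall X Y Z W : int, a * X ^+ 2 + b * Y ^+ 2 + c * Z ^+ 2 = N * W ^+ 2 ->
    [/\ (p%:Z %| X)%Z, (p%:Z %| Y)%Z, (p%:Z %| Z)%Z & (p%:Z %| W)%Z]) ->
  ~ represented_over_rat (diag_form a b c) N.
Proof.
move=> p1 H /rat_representation_int [X [Y [Z [W [W0 E]]]]].
have [n] := ubnP `|W|%N; elim: n X Y Z W W0 E => // n IH X Y Z W W0 E le_n.
have [/dvdzP[x Ex] /dvdzP[y Ey] /dvdzP[z Ez] /dvdzP[w Ew]] := H X Y Z W E.
have p0 : (p%:Z) ^+ 2 != 0 by rewrite expf_eq0 /=; lia.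
apply: (IH x y z w).
- by apply: contra_neq W0 => w0; rewrite Ew w0 mul0r.
- apply: (mulfI p0); rewrite Ex Ey Ez Ew in E.
  by rewrite !exprMn in E; lia.
- have w0 : (0 < `|w|)%N by rewrite absz_gt0; apply: contra_neq W0 => w0; rewrite Ew w0 mul0r.
  rewrite -ltnS; apply: leq_trans le_n; rewrite ltnS Ew abszM /=.
  exact: ltn_Pmulr.
Qed.

(** If [p] did not divide [y], then [x / y] modulo [p] would be a square root of [n]. *)
Lemma legendreN1_sqr_dvd (n : int) (p : nat) (x y : int) :
  prime p -> legendre n p = -1 -> (p%:Z %| x ^+ 2 - n * y ^+ 2)%Z ->
  (p%:Z %| x)%Z /\ (p%:Z %| y)%Z.
Proof.
move=> pp; rewrite /legendre; case: ifP => // pn; case: existsP => // Hex _ Hd.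
have p0 := prime_gt0 pp.
have prZ (u v : int) : (p%:Z %| u * v)%Z = (p%:Z %| u)%Z || (p%:Z %| v)%Z.
  by rewrite !dvdzE abszM Euclid_dvdM.
suff py : (p%:Z %| y)%Z.
  split=> //; have : (p%:Z %| x ^+ 2)%Z.
    by rewrite -(subrK (n * y ^+ 2) (x ^+ 2)) rpredD // dvdz_mull // expr2 dvdz_mull.
  by rewrite expr2 prZ orbb.
apply/negPn/negP => npy; apply: Hex.
have /coprimezP [[u v] /= Huv] : coprimez y p%:Z.
  by rewrite coprimez_sym coprimezE prime_coprime // -dvdzE.
have pz0 : (p%:Z != 0) by lia.
(* [u] inverts [y] modulo [p]; the product is reduced because [legendre] looks for roots in
   ['I_p]. *)
set w := (x * u %% p%:Z)%Z.
have w_ge0 : 0 <= w by rewrite modz_ge0.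
have w_lt : (`|w| < p)%N by have := ltz_mod (x * u) pz0; rewrite -/w; lia.
exists (Ordinal w_lt) => /=; rewrite gez0_abs //.
rewrite eqz_mod_dvd /w.
have -> : (x * u %% p%:Z)%Z = x * u - (x * u %/ p%:Z)%Z * p%:Z.
  by rewrite {2}(divz_eq (x * u) p%:Z) addrC addKr.
set q := (_ %/ _)%Z.
have Hv : 1 - u * y = v * p%:Z by rewrite -Huv; ring.
have -> : (x * u - q * p%:Z) ^+ 2 - n = (x ^+ 2 - n * y ^+ 2) * u ^+ 2
    + p%:Z * (p%:Z * q ^+ 2 - 2 * x * u * q) - n * (1 + u * y) * (1 - u * y).
  by ring.
by rewrite Hv; apply: rpredB; [apply: rpredD; apply: dvdz_mulr | rewrite mulrA dvdz_mull].
Qed.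

(** Modulo [p] the equation reads b Y^2 + c Z^2 = 0, so [p] divides [Y] and [Z], as -bc is a
    nonresidue. Dividing by [p] leaves a' X^2 = n W^2 modulo [p] with a' = a / p, and the nonresidue
    a' n forces [p] to divide [X] and [W]. *)
Lemma nonresidue_not_represented (a b c n : int) (p : nat) :
  odd_prime_factor p a -> legendre (- (b * c)) p = -1 ->
  legendre ((a %/ p%:Z)%Z * n) p = -1 ->
  ~ represented_over_rat (diag_form a b c) (n * p%:Z).
Proof.
case=> pp _ /dvdzP[a' Ea] Lbc.
have p1 := prime_gt1 pp.
have pz0 : p%:Z != 0 by rewrite -lt0n prime_gt0.
have prZ (u v : int) : (p%:Z %| u * v)%Z = (p%:Z %| u)%Z || (p%:Z %| v)%Z.
  by rewrite !dvdzE abszM Euclid_dvdM.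
rewrite {1}Ea mulzK // => Lan.
have npb : ~~ (p%:Z %| b)%Z.
  apply/negP => pb; move: Lbc; rewrite /legendre ifT //.
  by rewrite rpredN dvdz_mulr.
have npa' : ~~ (p%:Z %| a')%Z.
  by apply/negP => pa; move: Lan; rewrite /legendre ifT // dvdz_mulr.
apply: (not_represented_by_descent _ _ _ _ _ p1) => X Y Z W E.
have [pbY pZ] : (p%:Z %| b * Y)%Z /\ (p%:Z %| Z)%Z.
  apply: (legendreN1_sqr_dvd _ _ _ _ pp Lbc).
  apply/dvdzP; exists (b * (n * W ^+ 2 - a' * X ^+ 2)).
  have -> : (b * Y) ^+ 2 - - (b * c) * Z ^+ 2
    = b * ((a * X ^+ 2 + b * Y ^+ 2 + c * Z ^+ 2) - a * X ^+ 2) by ring.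
  by rewrite E Ea; ring.
have pY : (p%:Z %| Y)%Z by move: pbY; rewrite prZ (negbTE npb).
have /dvdzP[y Ey] := pY; have /dvdzP[z Ez] := pZ.
have [paX pW] : (p%:Z %| a' * X)%Z /\ (p%:Z %| W)%Z.
  apply: (legendreN1_sqr_dvd _ _ _ _ pp Lan).
  apply/dvdzP; exists (- a' * (b * y ^+ 2 + c * z ^+ 2)); apply: (mulIf pz0).
  have -> : ((a' * X) ^+ 2 - a' * n * W ^+ 2) * p%:Z
    = a' * ((a' * p%:Z) * X ^+ 2 - n * p%:Z * W ^+ 2) by ring.
  by rewrite -Ea -E Ey Ez; ring.
by split=> //; move: paX; rewrite prZ (negbTE npa').
Qed.

Lemma scaled_sqr_mod4 (a x : int) :
  (exists k, a * x ^+ 2 = 8 * k + a) \/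
  (2 %| x)%Z /\ exists k, a * x ^+ 2 = 4 * k.
Proof.
case: (sqr_dyadic_cases x) => [[k ->]|[dx [k ->]]|[dx [k ->]]].
- by left; exists (a * k); ring.
- by right; split=> //; exists (4 * a * k); ring.
- by right; split=> //; exists (a * (8 * k + 1)); ring.
Qed.

Lemma scaled_sqr_mod16 (a x : int) :
  [\/ exists k, a * x ^+ 2 = 8 * k + a,
      (2 %| x)%Z /\ exists k, a * x ^+ 2 = 16 * k
    | (2 %| x)%Z /\ exists k, a * x ^+ 2 = 16 * k + 4 * a].
Proof.
case: (sqr_dyadic_cases x) => [[k ->]|[dx [k ->]]|[dx [k ->]]].
- by apply: Or31; exists (a * k); ring.
- by apply: Or32; split=> //; exists (a * k); ring.
- by apply: Or33; split=> //; exists (2 * a * k); ring.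
Qed.

Lemma odd_of_coprime (a b : int) : coprimez a b -> (2 %| a)%Z -> (b %% 2)%Z = 1.
Proof.
move=> /coprimezP[[u v] /= Huv] /dvdzP[k Ek].
suff : ~~ (2 %| b)%Z by lia.
apply/negP => /dvdzP[l El].
have : 2 * (u * k + v * l) = 1 by rewrite -[RHS]Huv Ek El; ring.
by move: (u * k + v * l) => w; clear; lia.
Qed.

(** Let e = 1 or -1 be the common residue modulo 4. Then N = -e modulo 4, so the number of odd
    unknowns is a multiple of 4; all four odd is impossible because a + b + c - N = 4 modulo 8. *)
Lemma congruent_mod4_not_represented (a b c N : int) :
  coprimez a b -> congruent_mod4 a b c -> (N = - (a * b * c) %[mod 8])%Z ->
  ~ represented_over_rat (diag_form a b c) N.
Proof.
move=> cab [Eab Ebc] EN.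
have a_odd : (a %% 2)%Z = 1.
  have [/(odd_of_coprime _ _ cab)|] := boolP (2 %| a)%Z; lia.
have [e [i [Ea He]]] : exists e i, a = 4 * i + e /\ (e = 1 \/ e = -1).
  have [H|H] : (a %% 4)%Z = 1 \/ (a %% 4)%Z = 3 by lia.
  - by exists 1, (a %/ 4)%Z; lia.
  - by exists (-1), ((a %/ 4)%Z + 1); lia.
have [j Eb] : exists j, b = 4 * j + e by exists ((b - e) %/ 4)%Z; lia.
have [k Ec] : exists k, c = 4 * k + e by exists ((c - e) %/ 4)%Z; lia.
have [n En] : exists n, N = 8 * n - a * b * c
  by exists ((N + a * b * c) %/ 8)%Z; lia.
have Hs : ((a + b + c - N) %% 8)%Z = 4.
  have [q Hq] : exists q, a + b + c - N = 8 * q + 4 * e.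
    exists (i + j + k + 8 * i * j * k + 2 * e * (i * j + j * k + i * k) - n).
    rewrite En Ea Eb Ec; case: He => ->; ring.
  by clear -Hq He; lia.
have HN : ((N + e) %% 4)%Z = 0 by clear -Hs Ea Eb Ec He; lia.
have odd_e : (e %% 2)%Z = 1 by clear -He; lia.
apply: (@not_represented_by_descent 2) => // X Y Z W.
case: (scaled_sqr_mod4 a X) => [[x ->]|[dX [x ->]]];
case: (scaled_sqr_mod4 b Y) => [[y ->]|[dY [y ->]]];
case: (scaled_sqr_mod4 c Z) => [[z ->]|[dZ [z ->]]];
case: (scaled_sqr_mod4 N W) => [[w ->]|[dW [w ->]]] => E;
first [by split | exfalso; clear -E Hs HN Ea Eb Ec odd_e; lia].
Qed.

(** With a = 2m and N = 2M, [Y] and [Z] have equal parity. Both odd fails modulo 8; both even with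
    [X] or [W] odd fails modulo 16. *)
Lemma even_first_not_represented (a b c N : int) :
  squarefree a -> coprimez a b -> coprimez a c ->
  even_first_cond a b c -> (N = - (a * b * c) %[mod 16])%Z ->
  ~ represented_over_rat (diag_form a b c) N.
Proof.
move=> sfa cab cac [da cond] EN.
have odd_b := odd_of_coprime _ _ cab da.
have odd_c := odd_of_coprime _ _ cac da.
have /dvdzP[m Em] := da.
have odd_m : (m %% 2)%Z = 1.
  suff : ~~ (2 %| m)%Z by lia.
  apply/negP => dm; have : (2 ^+ 2 %| a)%Z by rewrite Em expr2 dvdz_mul.
  by move/sfa.
have [n En] : exists n, N = 2 * (8 * n - m * b * c).
  exists ((N + a * b * c) %/ 16)%Z; rewrite Em in EN *.
  have E2 : m * 2 * b * c = 2 * (m * b * c) by ring.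
  by rewrite E2 in EN; clear -EN; lia.
set M := 8 * n - m * b * c in En.
(* The alternatives come from b + c = 2a and b + c = a, in this order; as [m] is odd, 2a = 4m is 4
   modulo 8. Eliminating [c] from m - M gives the congruence for m - M. *)
have HM : ((b + c) %% 8)%Z = 4 /\ ((m - M) %% 8)%Z = 4 \/
  ((b + c - 2 * m) %% 8)%Z = 0 /\ ((m - M - 2 * b) %% 8)%Z = 0.
  have Eq : m - M = m * (1 + b * c) - 8 * n by rewrite /M; ring.
  case: cond => cond.
  - right; split; first by clear -cond Em; lia.
    have [q Hq] : exists q, b + c = 8 * q + 2 * m.
      by exists ((b + c - 2 * m) %/ 8)%Z; clear -cond Em; lia.
    have [k Hk] : exists k, b ^+ 2 = 8 * k + 1.
      by case: (sqr_dyadic_cases b) => // -[]; clear -odd_b; lia.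
    have [l Hl] : exists l, m ^+ 2 = 8 * l + 1.
      by case: (sqr_dyadic_cases m) => // -[]; clear -odd_m; lia.
    have -> : m - M - 2 * b = 8 * (m * b * q + 2 * b * l - m * k - n).
      have Ec : c = 8 * q + 2 * m - b by rewrite -Hq; ring.
      transitivity (m + 8 * m * b * q + 2 * b * m ^+ 2 - m * b ^+ 2 - 8 * n - 2 * b).
        by rewrite Eq Ec; ring.
      by rewrite Hk Hl; ring.
    by move: (m * b * q + _ - _ - _); clear => t; lia.
  - left; split; first by clear -cond Em odd_m; lia.
    have [q Hq] : exists q, b + c = 8 * q + 4.
      by exists ((b + c) %/ 8)%Z; clear -cond Em odd_m; lia.
    have [k Hk] : exists k, b ^+ 2 = 8 * k + 1.
      by case: (sqr_dyadic_cases b) => // -[]; clear -odd_b; lia.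
    have [l Hl] : exists l, m * b = 2 * l + 1.
      have [m1 Hm1] : exists m1, m = 2 * m1 + 1
        by exists (m %/ 2)%Z; clear -odd_m; lia.
      have [b1 Hb1] : exists b1, b = 2 * b1 + 1
        by exists (b %/ 2)%Z; clear -odd_b; lia.
      by exists (2 * m1 * b1 + m1 + b1); rewrite Hm1 Hb1; ring.
    have -> : m - M = 8 * (m * b * q + l - m * k - n) + 4.
      have Ec : c = 8 * q + 4 - b by rewrite -Hq; ring.
      transitivity (m + 8 * (m * b) * q + 4 * (m * b) - m * b ^+ 2 - 8 * n).
        by rewrite Eq Ec; ring.
      by rewrite Hk Hl; ring.
    by move: (m * b * q + _ - _ - _); clear => t; lia.
apply: (@not_represented_by_descent 2) => // X Y Z W; rewrite Em En => E.
have {}E : 2 * (m * X ^+ 2) + b * Y ^+ 2 + c * Z ^+ 2 = 2 * (M * W ^+ 2).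
  by rewrite mulrA [2 * m]mulrC E mulrA.
clearbody M; move: E.
case: (scaled_sqr_mod16 m X) => [[x ->]|[dX [x ->]]|[dX [x ->]]];
case: (scaled_sqr_mod16 b Y) => [[y ->]|[dY [y ->]]|[dY [y ->]]];
case: (scaled_sqr_mod16 c Z) => [[z ->]|[dZ [z ->]]|[dZ [z ->]]];
case: (scaled_sqr_mod16 M W) => [[w ->]|[dW [w ->]]|[dW [w ->]]] => E;
first [by split | exfalso; clear -E HM odd_m odd_b odd_c; lia].
Qed.

Lemma represented_swap12 (a b c N : int) :
  represented_over_rat (diag_form a b c) N ->
  represented_over_rat (diag_form b a c) N.
Proof. by case=> x [y [z E]]; exists y, x, z; rewrite -E /diag_form; ring. Qed.

Lemma represented_rot (a b c N : int) :
  represented_over_rat (diag_form a b c) N ->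
  represented_over_rat (diag_form c a b) N.
Proof. by case=> x [y [z E]]; exists z, x, y; rewrite -E /diag_form; ring. Qed.

(** * Hermite's bound for ternary forms *)

Lemma absz_decr (u v : int) (n : nat) :
  0 < u -> u < v -> (`|v| < n.+1)%N -> (`|u| < n)%N.
Proof. by lia. Qed.

Lemma round_div (A B : int) : 0 < A ->
  exists k : int, 4 * (B + k * A) ^+ 2 <= A ^+ 2.
Proof.
(* The quotient rounds B / A to the nearest integer, leaving a remainder of at most A / 2 in
   absolute value. *)
move=> A0; exists (- ((2 * B + A) %/ (2 * A))%Z).
have A2 : 2 * A != 0 by lia.
have := divz_eq (2 * B + A) (2 * A).
have := modz_ge0 (2 * B + A) A2; have := ltz_mod (2 * B + A) A2.
set q := (_ %/ _)%Z; set r := (_ %% _)%Z => lt_r ge_r E.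
have -> : B + - q * A = B - q * A by ring.
set s := B - q * A.
have Es : 2 * s = r - A by rewrite /s; lia.
have : (A - 2 * s) * (A + 2 * s) >= 0 by rewrite Es mulr_ge0; lia.
have -> : (A - 2 * s) * (A + 2 * s) = A ^+ 2 - 4 * s ^+ 2 by ring.
by lia.
Qed.

(** Gauss reduction: a translation gives |B| <= A / 2, and the outer coefficients are swapped as
    long as the last is smaller than the first. At the end A^2 <= AC <= disc + A^2 / 4. The whole
    unimodular matrix is kept because [ternary_hermite] extends it to a change of basis. *)
Lemma binary_hermite (A B C : int) : 0 < A -> 0 < A * C - B ^+ 2 ->
  exists p q r s : int, p * s - q * r = 1 /\
    let m := A * p ^+ 2 + 2 * B * p * r + C * r ^+ 2 in
    0 < m /\ 3 * m ^+ 2 <= 4 * (A * C - B ^+ 2).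
Proof.
have [n] := ubnP `|A|%N; elim: n A B C => // n IH A B C le_n A0 disc0.
have [k Hk] := round_div A B A0.
have EC : A * (A * k ^+ 2 + 2 * B * k + C) = (A * C - B ^+ 2) + (B + k * A) ^+ 2.
  by ring.
have C0 : 0 < A * k ^+ 2 + 2 * B * k + C.
  by rewrite -(pmulr_rgt0 _ A0) EC ltr_wpDr ?sqr_ge0.
have [ltC|leA] := ltP (A * k ^+ 2 + 2 * B * k + C) A.
- have disc' : (A * k ^+ 2 + 2 * B * k + C) * A - (- (B + k * A)) ^+ 2
      = A * C - B ^+ 2 by ring.
  have [||| p [q [r [s [det1 [m0 Hm]]]]]] :=
    IH (A * k ^+ 2 + 2 * B * k + C) (- (B + k * A)) A.
  + exact: absz_decr C0 ltC le_n.
  + by [].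
  + by rewrite disc'.
  (* The substitution (x, y) -> (kx - y, x), of determinant 1, is composed with the matrix from the
     recursion. *)
  exists (k * p - r), (k * q - s), p, q; split; first by rewrite -det1; ring.
  rewrite disc' in Hm.
  suff -> : A * (k * p - r) ^+ 2 + 2 * B * (k * p - r) * p + C * p ^+ 2 =
    (A * k ^+ 2 + 2 * B * k + C) * p ^+ 2 + 2 * (- (B + k * A)) * p * r + A * r ^+ 2.
    by [].
  by ring.
- exists 1, 0, 0, 1; split; first by ring.
  have -> : A * 1 ^+ 2 + 2 * B * 1 * 0 + C * 0 ^+ 2 = A by ring.
  split=> //; have : A * A <= A * (A * k ^+ 2 + 2 * B * k + C) by rewrite ler_pM2l.
  by rewrite EC -expr2; lia.
Qed.

Definition ternary (g11 g22 g33 g12 g13 g23 x y z : int) : int :=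
  g11 * x ^+ 2 + g22 * y ^+ 2 + g33 * z ^+ 2
  + 2 * (g12 * x * y + g13 * x * z + g23 * y * z).

(** The form of the symmetric matrix with entries [gij]; [ternary_det] is the determinant of that
    matrix. *)
Definition ternary_det (g11 g22 g33 g12 g13 g23 : int) : int :=
  g11 * g22 * g33 + 2 * (g12 * g13 * g23)
  - g11 * g23 ^+ 2 - g22 * g13 ^+ 2 - g33 * g12 ^+ 2.

(* The bound 64/27 det is the cube of Hermite's (4/3) det^(1/3). *)
Lemma ternary_hermite (g11 g22 g33 g12 g13 g23 : int) :
  0 < g11 -> 0 < g11 * g22 - g12 ^+ 2 ->
  0 < ternary_det g11 g22 g33 g12 g13 g23 ->
  exists x y z : int, let m := ternary g11 g22 g33 g12 g13 g23 x y z in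
    0 < m /\ 27 * m ^+ 3 <= 64 * ternary_det g11 g22 g33 g12 g13 g23.
Proof.
have [n] := ubnP `|g11|%N.
elim: n g11 g22 g33 g12 g13 g23 => // n IH g11 g22 g33 g12 g13 g23 le_n p1 p2 p3.
set d := ternary_det _ _ _ _ _ _ in p3 *.
(* Completing the square: g11 times the form is (g11 x + g12 y + g13 z)^2 + A y^2 + 2B yz + C
   z^2. *)
pose A := g11 * g22 - g12 ^+ 2.
pose B := g11 * g23 - g12 * g13.
pose C := g11 * g33 - g13 ^+ 2.
have EABC : A * C - B ^+ 2 = g11 * d by rewrite /A /B /C /d /ternary_det; ring.
have disc0 : 0 < A * C - B ^+ 2 by rewrite EABC mulr_gt0.
have [p [q [r [s [det1 [A'0 HA']]]]]] := binary_hermite A B C p2 disc0.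
set A' := A * _ + _ + _ in A'0 HA'; rewrite EABC in HA'.
have [k] := round_div g11 (g12 * p + g13 * r) p1.
set h12 := _ + k * g11 => Hk.
pose h22 := ternary g11 g22 g33 g12 g13 g23 k p r.
have Eh22 : g11 * h22 = A' + h12 ^+ 2.
  by rewrite /h22 /h12 /A' /A /B /C /ternary; ring.
have h22_gt0 : 0 < h22 by rewrite -(pmulr_rgt0 _ p1) Eh22 ltr_wpDr ?sqr_ge0.
have [lt_h|le_h] := ltP h22 g11.
(* Recursion in the basis (k, p, r), (1, 0, 0), (0, q, s), whose first vector has the smaller value
   [h22]. *)
- pose h33 := g22 * q ^+ 2 + 2 * g23 * q * s + g33 * s ^+ 2.
  pose h13 := g12 * q + g13 * s.
  pose h23 := g12 * k * q + g13 * k * s + g22 * p * q + g23 * (p * s + q * r) + g33 * r * s.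
  have Ed : ternary_det h22 g11 h33 h12 h23 h13 = d.
    have -> : d = d * (p * s - q * r) ^+ 2 by rewrite det1; ring.
    rewrite /ternary_det /h22 /h33 /h12 /h13 /h23 /d /ternary /ternary_det; ring.
  have [|||| x [y [z [m0 Hm]]]] := IH h22 g11 h33 h12 h23 h13.
  + exact: absz_decr h22_gt0 lt_h le_n.
  + by [].
  + by have -> : h22 * g11 - h12 ^+ 2 = A' by rewrite mulrC Eh22 addrK.
  + by rewrite Ed.
  exists (y + k * x), (p * x + q * z), (r * x + s * z).
  rewrite Ed in Hm.
  suff -> : ternary g11 g22 g33 g12 g13 g23 (y + k * x) (p * x + q * z) (r * x + s * z)
     = ternary h22 g11 h33 h12 h23 h13 x y z by [].
  by rewrite /ternary /h22 /h33 /h12 /h13 /h23 /ternary; ring.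
- exists 1, 0, 0.
  have -> : ternary g11 g22 g33 g12 g13 g23 1 0 0 = g11 by rewrite /ternary; ring.
  split=> //.
  (* This uses g11^2 <= g11 h22 = A' + h12^2 and 4 h12^2 <= g11^2. Squared and combined with 3 A'^2
     <= 4 g11 d, it gives 27 g11^4 <= 64 g11 d. *)
  have le1 : 3 * g11 ^+ 2 <= 4 * A'.
    have : g11 * g11 <= g11 * h22 by rewrite ler_pM2l.
    rewrite Eh22 -expr2; by move: (g11 ^+ 2) (h12 ^+ 2) {A'0 HA' Eh22} A' Hk; clear=> u v w; lia.
  have le2 : 9 * g11 ^+ 4 <= 16 * A' ^+ 2.
    have -> : 9 * g11 ^+ 4 = (3 * g11 ^+ 2) ^+ 2 by ring.
    have -> : 16 * A' ^+ 2 = (4 * A') ^+ 2 by ring.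
    by rewrite ler_sqr // nnegrE mulr_ge0 ?ltW // exprn_gt0.
  rewrite -(ler_pM2l p1).
  have -> : g11 * (27 * g11 ^+ 3) = 3 * (9 * g11 ^+ 4) by ring.
  have -> : g11 * (64 * d) = 16 * (4 * (g11 * d)) by ring.
  move: (g11 ^+ 4) (A' ^+ 2) (g11 * d) le2 HA'.
  by clear=> u v w; lia.
Qed.

(** * Definite forms with square conditions at the odd primes *)

Lemma crt (m n r s : int) : coprimez m n ->
  exists x, (m %| x - r)%Z /\ (n %| x - s)%Z.
Proof.
move=> co; exists (zchinese m n r s); rewrite -!eqz_mod_dvd.
by split; apply/eqP; [exact: zchinese_modl | exact: zchinese_modr].
Qed.

Lemma dvdz_sqrD (m x y d : int) :
  (m %| x - y)%Z -> (m %| y ^+ 2 + d)%Z -> (m %| x ^+ 2 + d)%Z.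
Proof.
move=> Hxy Hy; have -> : x ^+ 2 + d = (x - y) * (x + y) + (y ^+ 2 + d) by ring.
by rewrite rpredD // dvdz_mulr.
Qed.

Lemma legendre1_sqr (d : int) (p : nat) :
  legendre (- d) p = 1 -> exists x : int, (p%:Z %| x ^+ 2 + d)%Z.
Proof.
rewrite /legendre; case: ifP => // _; case: existsP => // -[x Hx] _.
by exists (x : nat)%:Z; move: Hx; rewrite eqz_mod_dvd opprK.
Qed.

(** Induction on |m|: squarefreeness makes a prime factor coprime to its cofactor, and the Chinese
    remainder theorem glues the two roots. *)
Lemma sqrt_mod_squarefree (m d : int) : m != 0 -> squarefree m ->
  (forall p : nat, prime p -> (p%:Z %| m)%Z ->
     exists x : int, (p%:Z %| x ^+ 2 + d)%Z) ->
  exists x : int, (m %| x ^+ 2 + d)%Z.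
Proof.
have [n] := ubnP `|m|%N; elim: n m => // n IH m le_n m0 sfm Hp.
have [m1|m1] := leqP `|m|%N 1.
  exists 0; rewrite dvdzE.
  have -> : `|m|%N = 1%N by apply/eqP; rewrite eqn_leq m1 absz_gt0.
  by rewrite dvd1n.
have pp := pdiv_prime m1; set p := pdiv _ in pp.
have pm : (p%:Z %| m)%Z by rewrite dvdzE pdiv_dvd.
have /dvdzP[q Eq] := pm.
have q0 : q != 0 by apply: contra_neq m0 => q0; rewrite Eq q0 mul0r.
have co : coprimez p%:Z q.
  rewrite coprimezE prime_coprime //; apply/negP => pq.
  have /sfm : (p%:Z ^+ 2 %| m)%Z by rewrite Eq expr2 dvdz_mul.
  by rewrite qualifE /=; have := prime_gt1 pp; lia.
have [|||| y Hy] := IH q.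
- rewrite -ltnS; apply: leq_trans le_n; rewrite ltnS Eq abszM /=.
  by rewrite ltn_Pmulr ?absz_gt0 ?prime_gt1.
- by [].
- by move=> e He; apply: sfm; rewrite Eq dvdz_mulr.
- by move=> l pl lq; apply: Hp => //; rewrite Eq dvdz_mulr.
have [z Hz] := Hp p pp pm.
have [x [Hx1 Hx2]] := crt _ _ z y co.
by exists x; rewrite Eq mulrC Gauss_dvdz // (dvdz_sqrD _ _ _ _ Hx1) // (dvdz_sqrD _ _ _ _ Hx2).
Qed.

Lemma binary_root (m b c x : int) : coprimez m b -> (m %| x ^+ 2 + b * c)%Z ->
  exists al : int, (m %| b * al ^+ 2 + c)%Z.
Proof.
move=> co Hx; have /coprimezP[[u v] /= Huv] := co.
(* [v] inverts [b] modulo [m]; multiplied by the unit [b], the value becomes x^2 + bc modulo [m]. *)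
exists (v * x); rewrite -(Gauss_dvdzr _ co).
have -> : b * (b * (v * x) ^+ 2 + c) = (v * b * x) ^+ 2 + b * c by ring.
apply: (dvdz_sqrD _ _ _ _ _ Hx).
have Evb : v * b = 1 - u * m by rewrite -Huv; ring.
have -> : v * b * x - x = m * (- u * x) by rewrite Evb; ring.
exact: dvdz_mulr.
Qed.

Lemma coprime_coef_root (a b c : int) : a != 0 -> squarefree a -> coprimez a b ->
  (forall p : nat, odd_prime_factor p a -> legendre (- (b * c)) p = 1) ->
  exists al : int, (a %| b * al ^+ 2 + c)%Z.
Proof.
move=> a0 sfa cab L.
have [x] : exists x : int, (a %| x ^+ 2 + b * c)%Z.
  apply: sqrt_mod_squarefree => // p pp pa.
  have [->|odd_p] := even_prime pp; last exact/legendre1_sqr/L.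
  (* The prime 2 is handled directly: y^2 + y is always even. *)
  exists (b * c); move: (b * c) => y.
  have [q [->|->]] : exists q, y = 2 * q \/ y = 2 * q + 1
    by exists (y %/ 2)%Z; lia.
  - by apply/dvdzP; exists (2 * q ^+ 2 + q); ring.
  - by apply/dvdzP; exists ((2 * q + 1) * (q + 1)); ring.
exact: binary_root.
Qed.

(** * Sublattices on which a definite form is divisible by a large modulus *)

(** The vectors (p, 0, 0), (r, q, 0), (s, t, l) span a lattice of index pql, on which the form has
    determinant abc (pql)^2. Hermite's bound gives a positive value there; being a multiple of [M],
    it is at least [M]. *)
Lemma diag_form_sublattice_index (a b c p q l r s t M : int) :
  0 < a -> 0 < b -> 0 < c -> 0 < p -> 0 < q -> 0 < l ->
  (forall u v w : int,
     (M %| a * (p * u + r * v + s * w) ^+ 2 + b * (q * v + t * w) ^+ 2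
         + c * (l * w) ^+ 2)%Z) ->
  27 * M ^+ 3 <= 64 * (a * b * c * (p * q * l) ^+ 2).
Proof.
move=> a0 b0 c0 p0 q0 l0 HM.
pose g11 := a * p ^+ 2; pose g12 := a * p * r; pose g13 := a * p * s.
pose g22 := a * r ^+ 2 + b * q ^+ 2; pose g23 := a * r * s + b * q * t.
pose g33 := a * s ^+ 2 + b * t ^+ 2 + c * l ^+ 2.
have Edet : ternary_det g11 g22 g33 g12 g13 g23 = a * b * c * (p * q * l) ^+ 2.
  by rewrite /ternary_det /g11 /g22 /g33 /g12 /g13 /g23; ring.
have [||| x [y [z [m0 Hm]]]] := ternary_hermite g11 g22 g33 g12 g13 g23.
- by rewrite !mulr_gt0 ?exprn_gt0.
- have -> : g11 * g22 - g12 ^+ 2 = a * b * (p * q) ^+ 2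
    by rewrite /g11 /g22 /g12; ring.
  by rewrite !mulr_gt0 ?exprn_gt0 ?mulr_gt0.
- by rewrite Edet !mulr_gt0 ?exprn_gt0 ?mulr_gt0.
rewrite Edet in Hm; apply: le_trans Hm; rewrite ler_pM2l //.
have [M0|M0] := leP M 0.
  by apply: (@le_trans _ _ 0); rewrite ?exprn_ge0 ?exprn_odd_le0 // ltW.
apply: lerXn2r; rewrite ?nnegrE; [exact: ltW | exact: ltW |].
have := HM x y z.
have <- : ternary g11 g22 g33 g12 g13 g23 x y z =
   a * (p * x + r * y + s * z) ^+ 2 + b * (q * y + t * z) ^+ 2 + c * (l * z) ^+ 2.
  by rewrite /ternary /g11 /g22 /g33 /g12 /g13 /g23; ring.
move: (ternary _ _ _ _ _ _ _ _ _) m0 => m m0 /dvdzP[k Ek].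
have k0 : 0 < k by rewrite Ek pmulr_lgt0 in m0.
by rewrite Ek ler_peMl ?(ltW M0).
Qed.

Lemma dvdz_diag_subst (n k1 k2 f g h : int) :
  (n %| f - g * h)%Z -> (n %| k1 * g ^+ 2 + k2)%Z ->
  (n %| k1 * f ^+ 2 + k2 * h ^+ 2)%Z.
Proof.
move=> Hf Hg.
have -> : k1 * f ^+ 2 + k2 * h ^+ 2
  = k1 * (f + g * h) * (f - g * h) + (k1 * g ^+ 2 + k2) * h ^+ 2 by ring.
by apply: rpredD; [exact: dvdz_mull | exact: dvdz_mulr].
Qed.

(* The vectors (b c A, 0, 0), (r, m B, 0), (s, t, C) span a lattice on which the
   form vanishes modulo K, modulo m (as y = al z there), modulo b (x = be z) and
   modulo c (x = ga y), hence modulo 4abc; but its index is also 4abc, and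
   Hermite's bound gives a positive value at most (16 * 64 / 27)^(1/3) abc,
   which is less than 4abc. *)
Lemma no_definite_sublattice (a b c m K A B C r0 s0 t0 : int) :
  0 < a -> 0 < b -> 0 < c -> 0 < m -> 0 < A -> 0 < B -> 0 < C ->
  (m %| a)%Z -> K * m = 4 * a -> A * B * C = K ->
  coprimez K m -> coprimez K b -> coprimez K c ->
  coprimez m b -> coprimez m c -> coprimez b c ->
  (exists al : int, (m %| b * al ^+ 2 + c)%Z) ->
  (exists be : int, (b %| a * be ^+ 2 + c)%Z) ->
  (exists ga : int, (c %| a * ga ^+ 2 + b)%Z) ->
  (forall r s t, (K %| r - r0)%Z -> (K %| s - s0)%Z -> (K %| t - t0)%Z ->
    forall u v w : int, (K %| a * (b * c * A * u + r * v + s * w) ^+ 2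
      + b * (m * B * v + t * w) ^+ 2 + c * (C * w) ^+ 2)%Z) ->
  False.
Proof.
move=> a0 b0 c0 m0 A0 B0 C0 ma EKm EK cKm cKb cKc cmb cmc cbc.
move=> [al Hal] [be Hbe] [ga Hga] HK.
(* The Chinese remainder theorem prescribes [t], [r], [s] modulo [K] and makes y = al z modulo [m],
   x = be z modulo [b] and x = ga y modulo [c] hold on the whole lattice. *)
have [t [Kt mt]] := crt _ _ t0 (al * C) cKm.
have cbc' : coprimez K (b * c) by rewrite coprimezMr cKb.
have [r1 [br1 cr1]] := crt _ _ 0 (ga * (m * B)) cbc.
have [r [Kr bcr]] := crt _ _ r0 r1 cbc'.
have [s1 [bs1 cs1]] := crt _ _ (be * C) (ga * t) cbc.
have [s [Ks bcs]] := crt _ _ s0 s1 cbc'.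
have br : (b %| r)%Z.
  have -> : r = (r - r1) + (r1 - 0) by ring.
  by rewrite rpredD //; apply: dvdz_trans bcr; rewrite dvdz_mulr.
have cr : (c %| r - ga * (m * B))%Z.
  have -> : r - ga * (m * B) = (r - r1) + (r1 - ga * (m * B)) by ring.
  by rewrite rpredD //; apply: dvdz_trans bcr; rewrite dvdz_mull.
have bs : (b %| s - be * C)%Z.
  have -> : s - be * C = (s - s1) + (s1 - be * C) by ring.
  by rewrite rpredD //; apply: dvdz_trans bcs; rewrite dvdz_mulr.
have cs : (c %| s - ga * t)%Z.
  have -> : s - ga * t = (s - s1) + (s1 - ga * t) by ring.
  by rewrite rpredD //; apply: dvdz_trans bcs; rewrite dvdz_mull.
have p0 : 0 < b * c * A by rewrite !mulr_gt0.
have q0 : 0 < m * B by rewrite mulr_gt0.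
have D0 : 0 < a * b * c by rewrite !mulr_gt0.
have E4 : 4 * (a * b * c) = K * (m * (b * c)).
  by transitivity (b * c * (K * m)); [rewrite EKm; ring | ring].
suff /(diag_form_sublattice_index _ _ _ _ _ _ _ _ _ _ a0 b0 c0 p0 q0 C0) :
  forall u v w : int, (4 * (a * b * c) %| a * (b * c * A * u + r * v + s * w) ^+ 2
      + b * (m * B * v + t * w) ^+ 2 + c * (C * w) ^+ 2)%Z.
  have -> : b * c * A * (m * B) * C = 4 * (a * b * c).
    by rewrite E4 -EK; ring.
  (* The contradiction is that 27 * 4^3 = 1728 exceeds 64 * 4^2 = 1024. *)
  have -> : 27 * (4 * (a * b * c)) ^+ 3 = 1728 * (a * b * c) ^+ 3 by ring.
  have -> : 64 * (a * b * c * (4 * (a * b * c)) ^+ 2) = 1024 * (a * b * c) ^+ 3 by ring.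
  have : 0 < (a * b * c) ^+ 3 by rewrite exprn_gt0.
  by move: ((a * b * c) ^+ 3); clear; lia.
move=> u v w; rewrite E4 !Gauss_dvdz ?coprimezMr ?cKm ?cKb ?cmb //.
set x := b * c * A * u + r * v + s * w.
set y := m * B * v + t * w; set z := C * w.
rewrite HK //=; apply/and3P; split.
- rewrite -addrA; apply: rpredD; first by rewrite dvdz_mulr.
  apply: (dvdz_diag_subst _ _ _ _ al); last exact: Hal.
  have -> : y - al * z = m * (B * v) + (t - al * C) * w by rewrite /y /z; ring.
  by apply: rpredD; apply: dvdz_mulr.
- rewrite addrAC; apply: rpredD; last by rewrite dvdz_mulr.
  apply: (dvdz_diag_subst _ _ _ _ be); last exact: Hbe.
  have -> : x - be * z = b * (c * A * u) + r * v + (s - be * C) * w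
    by rewrite /x /z; ring.
  by apply: rpredD; [apply: rpredD |]; apply: dvdz_mulr.
- apply: rpredD; last by rewrite dvdz_mulr.
  apply: (dvdz_diag_subst _ _ _ _ ga); last exact: Hga.
  have -> : x - ga * y = c * (b * A * u) + (r - ga * (m * B)) * v + (s - ga * t) * w
    by rewrite /x /y; ring.
  by apply: rpredD; [apply: rpredD |]; apply: dvdz_mulr.
Qed.

(** * Congruences at 2 for definite forms *)

(** If 4 divided a + b, the form would vanish modulo 4 on the lattice of index 4 given by x = y
    modulo 2 and z even, which [no_definite_sublattice] excludes. *)
Lemma definite_odd_sum_not_dvd4 (a b c : int) :
  0 < a -> 0 < b -> 0 < c ->
  squarefree a -> squarefree b -> squarefree c ->
  coprimez a b -> coprimez a c -> coprimez b c ->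
  (forall p, odd_prime_factor p a -> legendre (- (b * c)) p = 1) ->
  (forall p, odd_prime_factor p b -> legendre (- (a * c)) p = 1) ->
  (forall p, odd_prime_factor p c -> legendre (- (a * b)) p = 1) ->
  ~~ (2 %| a)%Z -> ~~ (2 %| b)%Z -> ~~ (2 %| c)%Z ->
  ~~ (4 %| a + b)%Z.
Proof.
move=> a0 b0 c0 sfa sfb sfc cab cac cbc La Lb Lc na nb nc.
apply/negP => /dvdzP[j Hj].
have co4 (n : int) : ~~ (2 %| n)%Z -> coprimez 4 n.
  by move=> nn; rewrite (_ : 4 = 2 ^+ 2) // coprimezXl // coprimezE prime_coprime // -dvdzE.
(* The 2-adic part of the lattice is x = y (mod 2), z = 0 (mod 2). *)
apply: (no_definite_sublattice a b c a 4 2 1 2 a 0 0) => //; try exact: co4.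
- by apply: coprime_coef_root; rewrite ?gt_eqF.
- by apply: coprime_coef_root; rewrite ?gt_eqF // coprimez_sym.
- by apply: coprime_coef_root; rewrite ?gt_eqF // coprimez_sym.
move=> r s t /dvdzP[k Ek] /dvdzP[l El] /dvdzP[n En] u v w.
(* Here x = av + 2e, y = av + 4nw and z = 2w; the only part not visibly divisible by 4 is (a + b)
   a^2 v^2 = 4j a^2 v^2. *)
apply/dvdzP; set e := b * c * u + 2 * k * v + 2 * l * w.
exists (j * a ^+ 2 * v ^+ 2 + a * (a * v * e + e ^+ 2) + 2 * a * b * n * v * w
  + 4 * b * n ^+ 2 * w ^+ 2 + c * w ^+ 2).
have Er : r = k * 4 + a by rewrite -Ek; ring.
have Es : s = l * 4 by rewrite -El; ring.
have Et : t = n * 4 by rewrite -En; ring.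
have Eb : b = j * 4 - a by rewrite -Hj; ring.
by rewrite Er Es Et /e Eb; ring.
Qed.

Lemma definite_even_first_cond (a b c : int) :
  0 < a -> 0 < b -> 0 < c ->
  squarefree a -> squarefree b -> squarefree c ->
  coprimez a b -> coprimez a c -> coprimez b c ->
  (forall p, odd_prime_factor p a -> legendre (- (b * c)) p = 1) ->
  (forall p, odd_prime_factor p b -> legendre (- (a * c)) p = 1) ->
  (forall p, odd_prime_factor p c -> legendre (- (a * b)) p = 1) ->
  (2 %| a)%Z -> even_first_cond a b c.
Proof.
move=> a0 b0 c0 sfa sfb sfc cab cac cbc La Lb Lc da; split=> //.
have odd_coprime (n : int) : ~~ (2 %| n)%Z -> coprimez 8 n.
  by move=> nn; rewrite (_ : 8 = 2 ^+ 3) // coprimezXl // coprimezE prime_coprime // -dvdzE.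
have na (n : int) : coprimez a n -> ~~ (2 %| n)%Z.
  by move=> can; have := odd_of_coprime _ _ can da; clear; lia.
have [m Em] : exists m, a = m * 2 by apply/dvdzP.
have ma : (m %| a)%Z by rewrite Em dvdz_mulr.
have nm : ~~ (2 %| m)%Z.
  apply/negP => dm; have : (2 ^+ 2 %| a)%Z by rewrite Em expr2 dvdz_mul.
  by move/sfa.
have m0 : 0 < m by rewrite Em pmulr_lgt0 in a0.
have K8 : 8 * m = 4 * a by rewrite Em; ring.
have cmb : coprimez m b by move: cab; rewrite Em coprimezMl => /andP[].
have cmc : coprimez m c by move: cac; rewrite Em coprimezMl => /andP[].
have [al Hal] : exists al : int, (m %| b * al ^+ 2 + c)%Z.
  have [|al Hal] := coprime_coef_root a b c _ sfa cab La; first by rewrite gt_eqF.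
  by exists al; apply: dvdz_trans Hal.
have Hbe : exists be : int, (b %| a * be ^+ 2 + c)%Z.
  by apply: coprime_coef_root; rewrite ?gt_eqF // coprimez_sym.
have Hga : exists ga : int, (c %| a * ga ^+ 2 + b)%Z.
  by apply: coprime_coef_root; rewrite ?gt_eqF // coprimez_sym.
(* Now K = 8 goes with the odd part m = a / 2, and the 2-adic index is 8 = 2 * 4 * 1. Two choices of
   [r0], [s0], [t0] exclude two residues. *)
have core r0 s0 t0 := no_definite_sublattice a b c m 8 2 4 1 r0 s0 t0
  a0 b0 c0 m0 isT isT isT ma K8 erefl (odd_coprime _ nm)
  (odd_coprime _ (na _ cab)) (odd_coprime _ (na _ cac)) cmb cmc cbc
  (ex_intro _ al Hal) Hbe Hga.
have nbc : ~~ (8 %| b + c)%Z.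
  (* 2-adic part: x = 0 (mod 2), y = z (mod 4). *)
  apply/negP => /dvdzP[j Hj]; apply: (core 0 0 1).
  move=> r s t /dvdzP[k Ek] /dvdzP[l El] /dvdzP[n En] u v w.
  have -> : r = k * 8 by rewrite -Ek; ring.
  have -> : s = l * 8 by rewrite -El; ring.
  have -> : t = n * 8 + 1 by rewrite -En; ring.
  (* Here x = 2e, y = w + 4g and z = w; in the second case x = w + 2e instead. *)
  pose e := b * c * u + 4 * k * v + 4 * l * w; pose g := m * v + 2 * n * w.
  apply/dvdzP; exists (m * e ^+ 2 + j * w ^+ 2 + b * (g * w + 2 * g ^+ 2)).
  have Ec : c = j * 8 - b by rewrite -Hj; ring.
  by rewrite /e /g Em Ec; ring.
have nabc : ~~ (8 %| a + b + c)%Z.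
  (* 2-adic part: x = z (mod 2), y = z (mod 4). *)
  apply/negP => /dvdzP[j Hj]; apply: (core 0 1 1).
  move=> r s t /dvdzP[k Ek] /dvdzP[l El] /dvdzP[n En] u v w.
  have -> : r = k * 8 by rewrite -Ek; ring.
  have -> : s = l * 8 + 1 by rewrite -El; ring.
  have -> : t = n * 8 + 1 by rewrite -En; ring.
  pose e := b * c * u + 4 * k * v + 4 * l * w; pose g := m * v + 2 * n * w.
  apply/dvdzP; exists (m * (e * w + e ^+ 2) + j * w ^+ 2 + b * (g * w + 2 * g ^+ 2)).
  have Ec : c = j * 8 - a - b by rewrite -Hj; ring.
  by rewrite /e /g Ec Em; ring.
have nb := na _ cab; have nc := na _ cac.
(* Here a = 2 modulo 4. If 4 divides b + c, then b + c = 4 = 2a modulo 8; otherwise a + b + c = 4,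
   so b + c = 4 - a = a modulo 8. *)
by clear -Em nm nb nc nbc nabc; lia.
Qed.

Lemma definite_congruences (a b c : int) :
  0 < a -> 0 < b -> 0 < c ->
  squarefree a -> squarefree b -> squarefree c ->
  coprimez a b -> coprimez a c -> coprimez b c ->
  (forall p, odd_prime_factor p a -> legendre (- (b * c)) p = 1) ->
  (forall p, odd_prime_factor p b -> legendre (- (a * c)) p = 1) ->
  (forall p, odd_prime_factor p c -> legendre (- (a * b)) p = 1) ->
  congruent_mod4 a b c \/ even_coef_cond a b c.
Proof.
move=> a0 b0 c0 sfa sfb sfc cab cac cbc La Lb Lc.
have cba : coprimez b a by rewrite coprimez_sym.
have cca : coprimez c a by rewrite coprimez_sym.
have ccb : coprimez c b by rewrite coprimez_sym.
have La' p : odd_prime_factor p a -> legendre (- (c * b)) p = 1.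
  by rewrite mulrC; apply: La.
have Lb' p : odd_prime_factor p b -> legendre (- (c * a)) p = 1.
  by rewrite mulrC; apply: Lb.
have Lc' p : odd_prime_factor p c -> legendre (- (b * a)) p = 1.
  by rewrite mulrC; apply: Lc.
have [da|na] := boolP (2 %| a)%Z.
  by right; apply: Or31; apply: definite_even_first_cond.
have [db|nb] := boolP (2 %| b)%Z.
  by right; apply: Or32; apply: definite_even_first_cond.
have [dc|nc] := boolP (2 %| c)%Z.
  by right; apply: Or33; apply: definite_even_first_cond.
left; have nab : ~~ (4 %| a + b)%Z by apply: (definite_odd_sum_not_dvd4 a b c).
have nbc : ~~ (4 %| b + c)%Z by apply: (definite_odd_sum_not_dvd4 b c a).
by rewrite /congruent_mod4; clear -na nb nc nab nbc; lia.
Qed.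

Theorem theorem1 (a b c : int)
  (a0 : a != 0) (b0 : b != 0) (c0 : c != 0)
  (sfa : squarefree a) (sfb : squarefree b) (sfc : squarefree c)
  (cab : coprimez a b) (cac : coprimez a c) (cbc : coprimez b c) :
  (* (1) *)
  ((forall (p : nat) (n : int), odd_prime_factor p a ->
      legendre (- (b * c)) p = -1 -> legendre ((a %/ p%:Z)%Z * n) p = -1 ->
      ~ represented_over_rat (diag_form a b c) (n * p%:Z)) /\
   (forall (p : nat) (n : int), odd_prime_factor p b ->
      legendre (- (a * c)) p = -1 -> legendre ((b %/ p%:Z)%Z * n) p = -1 ->
      ~ represented_over_rat (diag_form a b c) (n * p%:Z)) /\
   (forall (p : nat) (n : int), odd_prime_factor p c ->
      legendre (- (a * b)) p = -1 -> legendre ((c %/ p%:Z)%Z * n) p = -1 ->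
      ~ represented_over_rat (diag_form a b c) (n * p%:Z))) /\
  (* (2) *)
  (0 < a -> 0 < b -> 0 < c ->
   (forall p : nat, odd_prime_factor p a -> legendre (- (b * c)) p = 1) ->
   (forall p : nat, odd_prime_factor p b -> legendre (- (a * c)) p = 1) ->
   (forall p : nat, odd_prime_factor p c -> legendre (- (a * b)) p = 1) ->
   congruent_mod4 a b c \/ even_coef_cond a b c) /\
  (* (3) *)
  ((congruent_mod4 a b c ->
    forall N : int, (N = - (a * b * c) %[mod 8])%Z ->
      ~ represented_over_rat (diag_form a b c) N) /\
   (even_coef_cond a b c ->
    forall N : int, (N = - (a * b * c) %[mod 16])%Z ->
      ~ represented_over_rat (diag_form a b c) N)).
Proof.
have cba : coprimez b a by rewrite coprimez_sym.
have cca : coprimez c a by rewrite coprimez_sym.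
have ccb : coprimez c b by rewrite coprimez_sym.
split; [split; [|split] | split; [|split]].
- by move=> p n; apply: nonresidue_not_represented.
(* The claims about [b] and [c] reduce to those about the first coefficient by permuting the
   variables. *)
- move=> p n pb L1 L2 /represented_swap12.
  exact: nonresidue_not_represented.
- move=> p n pc L1 L2 /represented_rot.
  exact: nonresidue_not_represented.
- by move=> *; apply: definite_congruences.
- by move=> Hc N; apply: congruent_mod4_not_represented.
- case=> Hc N EN.
  + exact: even_first_not_represented Hc EN.
  + move=> /represented_swap12; apply: even_first_not_represented Hc _ => //.
    by rewrite (mulrC b).
  + move=> /represented_rot; apply: even_first_not_represented Hc _ => //.
    by rewrite -(mulrA c) (mulrC c).
Qed.
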